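(* Let $\mathfrak R$ be a complete, separated right linear topological ring, and let $\mathfrak B$ be a Bass flat left $\mathfrak R$-contramodule. If $\mathfrak B$ has a projective cover in $\mathfrak R\text{-contra}$, then $\mathfrak B$ is projective (as a left $\mathfrak R$-contramodule).
   Context: Rings are associative and unital. A topological ring $\mathfrak R$ is right linear if its open right ideals form a base of neighborhoods of zero; it is separated and complete if the natural map $\mathfrak R\to\varprojlim_{\mathfrak I}\mathfrak R/\mathfrak I$ ($\mathfrak I$ ranging over the open right ideals) is injective and surjective, respectively. Contramodules. For an abelian group $A$ and a set $X$, $A[X]=A^{(X)}$ is the direct sum of $X$ copies of $A$. For a set $X$, $\mathfrak R[[X]]=\varprojlim_{\mathfrak I}(\mathfrak R/\mathfrak I)[X]\subset\mathfrak R^X$ is the set of all formal linear combinations $\sum_{x\in X}r_xx$ whose family of coefficients converges to zero, i.e., for every open right ideal $\mathfrak I$ the set $\{x: r_x\notin\mathfrak I\}$ is finite. A map $f\colon X\to Y$ induces $\sum_x r_xx\mapsto\sum_y\bigl(\sum_{f(x)=y}r_x\bigr)y$ (infinite sums are limits of finite partial sums in $\mathfrak R$). With the unit $\epsilon_X\colon X\to\mathfrak R[[X]]$, $x\mapsto 1\cdot x$, and the ''opening of parentheses'' map $\phi_X\colon\mathfrak R[[\mathfrak R[[X]]]]\to\mathfrak R[[X]]$ (multiply coefficients and take the convergent sums), $\mathfrak R[[-]]$ is a monad on the category of sets. A left $\mathfrak R$-contramodule is an algebra over this monad, i.e., a set $\mathfrak C$ with a contraaction map $\pi_{\mathfrak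 C}\colon\mathfrak R[[\mathfrak C]]\to\mathfrak C$ satisfying associativity and unitality. Left $\mathfrak R$-contramodules form a cocomplete abelian category $\mathfrak R\text{-contra}$ with enough projectives; the projectives are the direct summands of the free contramodules $\mathfrak R[[X]]$. The free contramodule with one generator is $\mathfrak R[[*]]=\mathfrak R$. A Bass flat left $\mathfrak R$-contramodule is a contramodule of the form $\mathfrak B=\varinjlim(\mathfrak R\xrightarrow{*a_1}\mathfrak R\xrightarrow{*a_2}\mathfrak R\xrightarrow{*a_3}\cdots)$, the direct limit being computed in $\mathfrak R\text{-contra}$, where $a_1,a_2,a_3,\dots$ is a sequence of elements of $\mathfrak R$ and $*a\colon\mathfrak R\to\mathfrak R$ is the left contramodule morphism $r\mapsto ra$ of right multiplication with $a$. Covers. For a class of objects $\mathsf L$ in a category, a morphism $l\colon L\to A$ is an $\mathsf L$-precover if $L\in\mathsf L$ and every morphism $L'\to A$ with $L'\in\mathsf L$ factors through $l$; an $\mathsf L$-precover $l$ is an $\mathsf L$-cover if every endomorphism $f\colon L\to L$ with $lf=l$ is an automorphism. A projective cover is an $\mathsf L$-cover for $\mathsf L$ the class of projective objects. *)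

(* Defs.v *)
From HB Require Import structures.
From mathcomp Require Import all_boot all_algebra finmap.
From mathcomp Require Import boolp classical_sets functions cardinality.
From mathcomp Require Import topology tvs.
From mathcomp Require Import showcase.summability.

Set Implicit Arguments.
Unset Strict Implicit.
Unset Printing Implicit Defensive.

Import GRing.Theory.

Local Open Scope classical_set_scope.
Local Open Scope ring_scope.

(* The zero ring is allowed, hence PzRing. *)

HB.mixin Record TopologicalZmodule_isTopologicalPzRing R
    & TopologicalZmodule R & GRing.PzRing R := {
  mul_continuous : continuous (fun x : R * R => x.1 * x.2) ;
}.

#[short(type="topologicalPzRingType")]
HB.structure Definition TopologicalPzRing :=
  {R of TopologicalZmodule R & GRing.PzRing R
        & TopologicalZmodule_isTopologicalPzRing R}.

Definition right_ideal (R : pzRingType) (I : set R) : Prop :=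
  [/\ I 0, forall x y, I x -> I y -> I (x - y)
    & forall x r, I x -> I (x * r)].

Definition open_right_ideal (R : topologicalPzRingType) (I : set R) : Prop :=
  open I /\ right_ideal I.

(* [rl_separated] and [rl_complete] say that the natural map
   R -> lim_I R/I, with I ranging over the open right ideals, is injective,
   resp. surjective; an element of the limit is given by a family [x] of
   representatives, [x I] representing the component in R/I. *)
HB.mixin Record TopologicalPzRing_isCompleteRightLinear R
    & TopologicalPzRing R := {
  right_linear : forall U : set R, nbhs 0 U ->
    exists2 I : set R, open_right_ideal I & I `<=` U ;
  rl_separated : forall r : R,
    (forall I : set R, open_right_ideal I -> I r) -> r = 0 ;
  rl_complete : forall x : set R -> R,
    (forall I J : set R, open_right_ideal I -> open_right_ideal J ->
       J `<=` I -> I (x J - x I)) ->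
    exists r : R, forall I : set R, open_right_ideal I -> I (r - x I) ;
}.

#[short(type="completeRightLinearRingType")]
HB.structure Definition CompleteRightLinearRing :=
  {R of TopologicalPzRing R & TopologicalPzRing_isCompleteRightLinear R}.

Definition null_family (R : topologicalPzRingType) (X : Type) (r : X -> R)
    : Prop :=
  forall I : set R, open_right_ideal I -> finite_set [set x | ~ I (r x)].

(* Limit of the finite partial sums (0 if it does not exist). *)
Definition family_sum (R : topologicalPzRingType) (X : choiceType)
    (r : X -> R) : R :=
  xget 0 [set s | partial_sum r @ totally --> s].

(* The set R[[X]]. *)
Record lincomb (R : topologicalPzRingType) (X : Type) := LinComb {
  coef :> X -> R ;
  coef_null : null_family coef
}.

HB.instance Definition _ R X := gen_eqMixin (lincomb R X).
HB.instance Definition _ R X := gen_choiceMixin (lincomb R X).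

Section RightIdeals.
Variable R : completeRightLinearRingType.
Implicit Types I J : set R.

Lemma ori0 I : open_right_ideal I -> I 0.
Proof. by case=> _ []. Qed.

Lemma oriB I x y : open_right_ideal I -> I x -> I y -> I (x - y).
Proof. by case=> _ [_ + _]; apply. Qed.

Lemma oriN I x : open_right_ideal I -> I x -> I (- x).
Proof. by move=> oI Ix; rewrite -sub0r; apply: oriB => //; apply: ori0. Qed.

Lemma oriD I x y : open_right_ideal I -> I x -> I y -> I (x + y).
Proof. by move=> oI Ix Iy; rewrite -[y]opprK; apply: oriB => //; apply: oriN. Qed.

Lemma oriM I x r : open_right_ideal I -> I x -> I (x * r).
Proof. by case=> _ [_ _ +]; apply. Qed.

Lemma ori_sum I (X : Type) (s : seq X) (P : pred X) (f : X -> R) :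
  open_right_ideal I -> (forall x, P x -> I (f x)) ->
  I (\sum_(x <- s | P x) f x).
Proof. by move=> oI h; elim/big_ind: _ => //; [apply: ori0|move=> *; apply: oriD]. Qed.

Lemma ori_trans I y x z : open_right_ideal I ->
  I (x - y) -> I (y - z) -> I (x - z).
Proof. by move=> oI xy yz; rewrite -(subrKA y); apply: oriD. Qed.

Lemma ori_sym I x y : open_right_ideal I -> I (x - y) -> I (y - x).
Proof. by move=> oI h; rewrite -opprB; apply: oriN. Qed.

Lemma ori_nbhs I : open_right_ideal I -> nbhs 0 I.
Proof. by move=> oI; apply: open_nbhs_nbhs; split; [case: oI|apply: ori0]. Qed.

Lemma ori_lmul I (a : R) : open_right_ideal I ->
  exists2 J, open_right_ideal J & forall x, J x -> I (a * x).
Proof.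
move=> oI.
have ca : {for 0, continuous (fun x : R => a * x)}.
  apply: (@continuous_comp _ _ _ (fun x : R => (a, x))
    (fun x : R * R => x.1 * x.2)); last exact: mul_continuous.
  by apply: cvg_pair; [exact: cvg_cst|exact: cvg_id].
have : nbhs 0 ((fun x : R => a * x) @^-1` I).
  by apply: ca; rewrite /= mulr0; apply: ori_nbhs.
by move=> /right_linear[J oJ JI]; exists J.
Qed.

Lemma nbhs_ori (s : R) (U : set R) : nbhs s U ->
  exists2 I, open_right_ideal I & forall t, I (t - s) -> U t.
Proof.
move=> sU.
have cs : {for 0, continuous (fun x : R => x + s)}.
  apply: (@continuous_comp _ _ _ (fun x : R => (x, s))
    (fun x : R * R => x.1 + x.2)); last exact: add_continuous.
  by apply: cvg_pair; [exact: cvg_id|exact: cvg_cst].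
have : nbhs 0 ((fun x : R => x + s) @^-1` U).
  by apply: cs; rewrite /= add0r.
move=> /right_linear[I oI IU]; exists I => // t /IU /=.
by rewrite subrK.
Qed.

Lemma ori_near (s : R) I : open_right_ideal I -> nbhs s [set t | I (t - s)].
Proof.
move=> oI.
have cs : {for s, continuous (fun x : R => x - s)}.
  apply: (@continuous_comp _ _ _ (fun x : R => (x, s))
    (fun x : R * R => x.1 - x.2)); last exact: sub_continuous.
  by apply: cvg_pair; [exact: cvg_id|exact: cvg_cst].
by apply: cs; rewrite /= subrr; apply: ori_nbhs.
Qed.

Lemma eq_ori (x y : R) : (forall I, open_right_ideal I -> I (x - y)) -> x = y.
Proof. by move=> h; apply/subr0_eq/rl_separated. Qed.

End RightIdeals.

Section FamilySum.
Variable R : completeRightLinearRingType.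
Implicit Types (I J : set R).

Lemma partial_sumE (X : choiceType) (r : X -> R) (A : {fset X}) :
  partial_sum r A = \sum_(x <- A) r x.
Proof. by by rewrite [RHS]big_seq_fsetE. Qed.

Lemma ori_sum_sub (X : choiceType) (r : X -> R) (A B : {fset X}) I :
  open_right_ideal I -> (A `<=` B)%fset -> (forall x, x \notin A -> I (r x)) ->
  I (\sum_(x <- B) r x - \sum_(x <- A) r x).
Proof.
move=> oI AB rI.
rewrite (big_fsetID _ (mem A) B) /=.
have -> : [fset x in B | x \in A]%fset = A.
  by apply/fsetP => x; rewrite !inE andbC; case: (boolP (x \in A)) => //= /(fsubsetP AB).
rewrite [X in I (X - _)]addrC addrK big_seq_cond.
apply: ori_sum => // x; rewrite andbT !inE => /andP[_ /= xA]; exact: rI.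
Qed.

Lemma null_fset (X : choiceType) (r : X -> R) I : null_family r ->
  open_right_ideal I -> exists A : {fset X}, forall x, x \notin A -> I (r x).
Proof.
move=> nr oI; have fin := nr _ oI; exists (fset_set [set x | ~ I (r x)]) => x.
by rewrite in_fset_set // notin_setE /= => /contrapT.
Qed.

Lemma family_sum_cvg (X : choiceType) (r : X -> R) : null_family r ->
  partial_sum r @ totally --> family_sum r.
Proof.
move=> nr; apply: (@xgetPex _ 0 [set s | partial_sum r @ totally --> s]).
pose supp I := fset_set [set x | ~ I (r x)].
have suppP I x : open_right_ideal I -> x \notin supp I -> I (r x).
  by move=> oI; rewrite in_fset_set; [rewrite notin_setE /= => /contrapT|exact: nr].
have [|s hs] := @rl_complete R (fun I => \sum_(x <- supp I) r x).
  move=> I J oI oJ JI; apply: ori_sum_sub => //; last by move=> x; exact: suppP.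
  apply/fsubsetP => x; rewrite !in_fset_set ?inE /=; [|exact: nr..].
  by move=> nI /JI.
exists s => U /nbhs_ori[I oI IU]; exists (supp I) => // B /= AB; apply: IU.
rewrite partial_sumE; apply: (ori_trans (y := \sum_(x <- supp I) r x)) => //.
  by apply: ori_sum_sub => // x; exact: suppP.
by apply: ori_sym => //; apply: hs.
Qed.

Lemma family_sum_ori (X : choiceType) (r : X -> R) (A : {fset X}) I :
  null_family r -> open_right_ideal I -> (forall x, x \notin A -> I (r x)) ->
  I (family_sum r - \sum_(x <- A) r x).
Proof.
move=> nr oI rI; have /(_ _ (ori_near _ oI)) := family_sum_cvg nr.
case=> B _ /(_ (A `|` B)%fset) /= h.
have /h : (B `<=` A `|` B)%fset by rewrite fsubsetUr.
rewrite partial_sumE => /(ori_sym oI) h'; apply: (ori_trans oI h').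
by apply: ori_sum_sub => //; rewrite fsubsetUl.
Qed.

Lemma family_sum_in (X : choiceType) (r : X -> R) I : null_family r ->
  open_right_ideal I -> (forall x, I (r x)) -> I (family_sum r).
Proof.
move=> nr oI rI; have := @family_sum_ori _ _ fset0 I nr oI (fun x _ => rI x).
by rewrite big_nil subr0.
Qed.

Lemma null_mulr (X : Type) (r g : X -> R) :
  null_family r -> null_family (fun x => r x * g x).
Proof.
move=> nr I oI; apply: sub_finite_set (nr I oI) => x /=.
by apply: contra_not; apply: oriM.
Qed.

Lemma family_sum_delta (Y : choiceType) (y0 : Y) (g : Y -> R) :
  family_sum (fun y => (y0 == y)%:R * g y) = g y0.
Proof.
have nd : null_family (fun y => (y0 == y)%:R : R).
  move=> I oI; apply: sub_finite_set (finite_set1 y0) => y /=.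
  by case: eqP => // _ /(_ (ori0 oI)).
apply: eq_ori => I oI.
have := @family_sum_ori _ (fun y => (y0 == y)%:R * g y) [fset y0]%fset I.
rewrite big_seq_fset1 eqxx mul1r; apply=> //; first exact: null_mulr.
by move=> x; rewrite inE eq_sym => /negPf ->; rewrite mul0r; apply: ori0.
Qed.

Lemma null_delta (Y : choiceType) (y0 : Y) :
  null_family (fun y => (y0 == y)%:R : R).
Proof.
move=> I oI; apply: sub_finite_set (finite_set1 y0) => y /=.
by case: eqP => // _ /(_ (ori0 oI)).
Qed.

Section Fubini.
Variables (Z Y : choiceType) (w : Z -> R) (c : Z -> Y -> R).
Hypotheses (nw : null_family w) (nc : forall z, null_family (c z)).

Lemma null_comb_aux I : open_right_ideal I ->
  exists (A : {fset Z}) (B : {fset Y}) (J : Z -> set R),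
    [/\ forall z, z \notin A -> I (w z),
        forall z, open_right_ideal (J z),
        forall z x, J z x -> I (w z * x)
      & forall z y, z \in A -> y \notin B -> J z (c z y)].
Proof.
move=> oI; have [A wI] := null_fset nw oI.
have /choice[J hJ] : forall z, exists J,
    open_right_ideal J /\ forall x, J x -> I (w z * x).
  by move=> z; have [J ? ?] := ori_lmul (w z) oI; exists J.
have fB : finite_set (\bigcup_(z in [set` A]) [set y | ~ J z (c z y)]).
  apply: bigcup_finite => // z _; apply: nc; exact: (hJ z).1.
exists A, (fset_set (\bigcup_(z in [set` A]) [set y | ~ J z (c z y)])), J.
split=> //; [by move=> z; case: (hJ z)|by move=> z; case: (hJ z)|].
move=> z y zA; rewrite in_fset_set // notin_setE => h.
by apply: contrapT => nJ; apply: h; exists z.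
Qed.

Lemma null_comb : null_family (fun y => family_sum (fun z => w z * c z y)).
Proof.
move=> I oI; have [A [B [J [wI oJ JI cJ]]]] := null_comb_aux oI.
apply: sub_finite_set (finite_fset B) => y /=; apply: contra_notP => /negP yB.
apply: family_sum_in => //; first exact: null_mulr.
move=> z; case: (boolP (z \in A)) => zA; first by apply: (JI z); apply: cJ.
by apply: oriM => //; apply: wI.
Qed.

Lemma family_sum_exchange (g : Y -> R) :
  family_sum (fun y => family_sum (fun z => w z * c z y) * g y) =
  family_sum (fun z => w z * family_sum (fun y => c z y * g y)).
Proof.
apply: eq_ori => I oI; have [A [B [J [wI oJ JI cJ]]]] := null_comb_aux oI.
have wcI z y : y \notin B -> I (w z * c z y).
  move=> yB; case: (boolP (z \in A)) => zA; first by apply: (JI z); apply: cJ.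
  by apply: oriM => //; apply: wI.
apply: (ori_trans
    (y := \sum_(y <- B) family_sum (fun z => w z * c z y) * g y)) => //.
  apply: family_sum_ori => //; first by apply: null_mulr; apply: null_comb.
  move=> y yB; apply: oriM => //; apply: family_sum_in => //.
    exact: null_mulr.
  by move=> z; apply: wcI.
apply: (ori_trans
    (y := \sum_(z <- A) w z * family_sum (fun y => c z y * g y))) => //; last first.
  apply: ori_sym => //; apply: family_sum_ori => //; first exact: null_mulr.
  by move=> z zA; apply: oriM => //; apply: wI.
apply: (ori_trans
    (y := \sum_(y <- B) (\sum_(z <- A) w z * c z y) * g y)) => //.
  rewrite -sumrB; apply: ori_sum => // y _; rewrite -mulrBl; apply: oriM => //.
  apply: family_sum_ori => //; first exact: null_mulr.
  by move=> z zA; apply: oriM => //; apply: wI.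
have -> : \sum_(y <- B) (\sum_(z <- A) w z * c z y) * g y =
    \sum_(z <- A) w z * \sum_(y <- B) c z y * g y.
  under eq_bigr do rewrite mulr_suml.
  rewrite exchange_big /=; apply: eq_bigr => z _; rewrite mulr_sumr.
  by apply: eq_bigr => y _; rewrite mulrA.
rewrite -sumrB big_seq_cond; apply: ori_sum => // z; rewrite andbT => zA.
rewrite -mulrBr; apply: (JI z); apply: ori_sym => //.
apply: family_sum_ori => //; first exact: null_mulr.
by move=> y yB; apply: oriM => //; apply: cJ.
Qed.

End Fubini.

Lemma pushforward_sumE (X Y : choiceType) (f : X -> Y) (r : X -> R) (y : Y) :
  family_sum (fun x => if f x == y then r x else 0) =
  family_sum (fun x => r x * (f x == y)%:R).
Proof.
by congr family_sum; apply/funext => x; case: eqP; rewrite ?mulr1 ?mulr0.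
Qed.

Lemma pushforward_null (X Y : choiceType) (f : X -> Y) (r : X -> R) :
  null_family r ->
  null_family (fun y => family_sum (fun x => if f x == y then r x else 0)).
Proof.
move=> nr; under [X in null_family X]eq_fun do rewrite pushforward_sumE.
by apply: null_comb => // z; apply: null_delta.
Qed.

Lemma pushforward_sum (X Y : choiceType) (f : X -> Y) (r : X -> R)
    (g : Y -> R) : null_family r ->
  family_sum
    (fun y => family_sum (fun x => if f x == y then r x else 0) * g y) =
  family_sum (fun x => r x * g (f x)).
Proof.
move=> nr.
under [X in family_sum X = _]eq_fun do rewrite pushforward_sumE.
rewrite family_sum_exchange //; last by move=> z; apply: null_delta.
by congr family_sum; apply/funext => x; rewrite family_sum_delta.
Qed.

Lemma family_sum_mulr (X : choiceType) (r g : X -> R) (a : R) :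
  null_family r ->
  family_sum (fun x => r x * g x) * a = family_sum (fun x => r x * (g x * a)).
Proof.
have unitE (h : R) : family_sum (fun _ : unit => h) = h.
  rewrite -[RHS](family_sum_delta tt (fun=> h)).
  by congr family_sum; apply/funext => -[]; rewrite eqxx mul1r.
move=> nr; rewrite -[LHS]unitE.
rewrite (family_sum_exchange (c := fun x (_ : unit) => g x) nr) //.
  by congr family_sum; apply/funext => x; rewrite unitE.
by move=> z I oI; apply: finite_finset.
Qed.

End FamilySum.

Section Monad.
Variable R : completeRightLinearRingType.

Definition lincomb_map (X Y : choiceType) (f : X -> Y) (r : lincomb R X)
    : lincomb R Y :=
  @LinComb R Y (fun y => family_sum (fun x => if f x == y then r x else 0))
    (pushforward_null f (coef_null r)).

Definition lincomb_unit (X : choiceType) (x : X) : lincomb R X :=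
  @LinComb R X (fun y => (x == y)%:R) (@null_delta R X x).

Definition lincomb_join (X : choiceType) (r : lincomb R (lincomb R X))
    : lincomb R X :=
  @LinComb R X (fun x => family_sum (fun u : lincomb R X => r u * u x))
    (null_comb (c := @coef R X) (coef_null r) (@coef_null R X)).

End Monad.

HB.mixin Record isContramodule (R : completeRightLinearRingType) C
    & Choice C := {
  contraact : lincomb R C -> C ;
  contraact_join : forall c : lincomb R (lincomb R C),
    contraact (lincomb_join c) = contraact (lincomb_map contraact c) ;
  contraact_unit : forall x : C, contraact (lincomb_unit R x) = x ;
}.

#[short(type="contramodType")]
HB.structure Definition Contramodule (R : completeRightLinearRingType) :=
  {C of Choice C & isContramodule R C}.

Record contrahom (R : completeRightLinearRingType) (C D : contramodType R) :=
  ContraHom {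
    contrahom_fun :> C -> D ;
    contrahomP : forall c : lincomb R C,
      contrahom_fun (contraact c) = contraact (lincomb_map contrahom_fun c)
  }.

(* The free contramodule with one generator R[[ * ]] = R; the contraaction
   sends a formal linear combination of elements of R to its value. *)
Section RegularContramodule.
Variable R : completeRightLinearRingType.

Definition regular_contra : Type := R.
HB.instance Definition _ := Choice.on regular_contra.

Definition regular_act (r : lincomb R regular_contra) : regular_contra :=
  family_sum (fun s : R => coef r s * s).

Lemma regular_act_join (r : lincomb R (lincomb R regular_contra)) :
  regular_act (lincomb_join r) = regular_act (lincomb_map regular_act r).
Proof.
rewrite /regular_act /= (pushforward_sum _ (fun s => s) (coef_null r)).
by rewrite family_sum_exchange //; [exact: coef_null|move=> u; exact: coef_null].
Qed.

Lemma regular_act_unit (x : regular_contra) :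
  regular_act (lincomb_unit R x) = x.
Proof. exact: (family_sum_delta (x : R) id). Qed.

HB.instance Definition _ :=
  isContramodule.Build R regular_contra regular_act_join regular_act_unit.

Lemma regular_mulr_hom (a : R) (r : lincomb R regular_contra) :
  (contraact r : R) * a =
  contraact (lincomb_map (fun s : regular_contra => (s : R) * a : regular_contra) r).
Proof.
rewrite /contraact /= /regular_act /=.
rewrite (pushforward_sum _ (fun s => s) (coef_null r)).
exact: family_sum_mulr (coef_null r).
Qed.

Definition regular_mulr (a : R)
    : contrahom (regular_contra : contramodType R) regular_contra :=
  @ContraHom R regular_contra regular_contra
    (fun s => (s : R) * a) (regular_mulr_hom a).

End RegularContramodule.

Section Category.
Variable R : completeRightLinearRingType.
Implicit Types A B C D L P Q : contramodType R.

Definition contra_automorphism P (f : contrahom P P) : Prop :=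
  exists g : contrahom P P, cancel f g /\ cancel g f.

Definition contra_epi C D (e : contrahom C D) : Prop :=
  forall A (g h : contrahom D A), g \o e =1 h \o e -> g =1 h.

Definition contra_projective P : Prop :=
  forall C D (e : contrahom C D), contra_epi e ->
  forall f : contrahom P D, exists g : contrahom P C, e \o g =1 f.

Definition contra_precover (K : contramodType R -> Prop) L A
    (l : contrahom L A) : Prop :=
  K L /\ forall Q, K Q -> forall q : contrahom Q A,
    exists h : contrahom Q L, l \o h =1 q.

Definition contra_cover (K : contramodType R -> Prop) L A
    (l : contrahom L A) : Prop :=
  contra_precover K l /\
  forall f : contrahom L L, l \o f =1 l -> contra_automorphism f.

Definition has_projective_cover A : Prop :=
  exists L (l : contrahom L A), contra_cover contra_projective l.

Definition is_cocone (C : nat -> contramodType R)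
    (t : forall n, contrahom (C n) (C n.+1)) L
    (i : forall n, contrahom (C n) L) : Prop :=
  forall n, i n.+1 \o t n =1 i n.

Definition is_direct_limit (C : nat -> contramodType R)
    (t : forall n, contrahom (C n) (C n.+1)) L
    (i : forall n, contrahom (C n) L) : Prop :=
  is_cocone t i /\
  forall D (j : forall n, contrahom (C n) D), is_cocone t j ->
    exists u : contrahom L D, (forall n, u \o i n =1 j n) /\
      forall v : contrahom L D, (forall n, v \o i n =1 j n) -> v =1 u.

Definition bass_flat B : Prop :=
  exists (a : nat -> R)
    (i : forall n : nat, contrahom (regular_contra R : contramodType R) B),
    is_direct_limit (fun n => regular_mulr (a n)) i.

End Category.

(* Main.v *)
(* Let b_n be the generators of B, F the free contramodule on e_0, e_1, ..., and
   q : F -> B, e_n |-> b_n; then ker q is the image of the telescope map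
   k : e_n |-> e_n - a_n e_{n+1}. Given a projective cover l : P -> B, lift l to
   g : P -> F along q, and q to h : F -> P along l. The endomorphism c_m of F
   sending e_n to a_n ... a_{m-1} e_m for n < m and fixing e_n for n >= m
   satisfies q c_m = q, so h c_m g is an automorphism of P. If l x = l x', then
   g x - g x' = k y for some y; the coefficients of y tend to zero, so for every
   open right ideal I there is m with c_m (k y) in I F. Applying the inverse of
   h c_m g gives g x - g x' in I F, for every I; hence g x = g x' and, h g being
   an automorphism, x = x'. So l is injective; the elements h e_n then satisfy
   the relations of the b_n, which gives a section of l. *)
From HB Require Import structures.
From mathcomp Require Import all_boot all_algebra finmap.
From mathcomp Require Import boolp classical_sets functions cardinality.
From mathcomp Require Import generic_quotient.
Require Import Defs.

Set Implicit Arguments.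
Unset Strict Implicit.
Unset Printing Implicit Defensive.

Import GRing.Theory.

Local Open Scope ring_scope.
Local Open Scope quotient_scope.

(** * Additivity of convergent infinite sums *)

Section FamilySums.
Variable R : completeRightLinearRingType.

Lemma nullB (X : choiceType) (f g : X -> R) :
  null_family f -> null_family g -> null_family (fun x => f x - g x).
Proof.
move=> nf ng I oI.
have [A hA] := null_fset nf oI; have [B hB] := null_fset ng oI.
apply: sub_finite_set (finite_fset (A `|` B)%fset) => x /=.
apply: contra_notP => /negP; rewrite inE => /norP[xA xB].
by apply: oriB => //; [exact: hA|exact: hB].
Qed.

Lemma null0 (X : Type) : null_family (fun _ : X => 0 : R).
Proof.
by move=> I oI; apply: sub_finite_set (finite_set0 X) => x /(_ (ori0 oI)).
Qed.

(** Modulo an open right ideal [I], all three sums reduce to finite sums over one finite set outside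
    which both families lie in [I]. *)
Lemma family_sumB (X : choiceType) (f g : X -> R) :
  null_family f -> null_family g ->
  family_sum (fun x => f x - g x) = family_sum f - family_sum g.
Proof.
move=> nf ng; apply: eq_ori => I oI.
have [A hA] := null_fset nf oI; have [B hB] := null_fset ng oI.
have hf x : x \notin (A `|` B)%fset -> I (f x).
  by rewrite inE => /norP[xA _]; exact: hA.
have hg x : x \notin (A `|` B)%fset -> I (g x).
  by rewrite inE => /norP[_ xB]; exact: hB.
apply: (ori_trans (y := \sum_(x <- (A `|` B)%fset) (f x - g x))) => //.
  apply: family_sum_ori => //; first exact: nullB.
  by move=> x xAB; apply: oriB => //; [exact: hf|exact: hg].
apply: ori_sym => //.
rewrite sumrB opprD addrACA -opprD.
by apply: oriB => //; exact: family_sum_ori.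
Qed.

Lemma family_sum0 (X : choiceType) : family_sum (fun _ : X => 0 : R) = 0.
Proof.
rewrite -[RHS](subrr (family_sum (fun _ : X => 0 : R))).
rewrite -family_sumB; [|exact: null0..].
by congr family_sum; apply/funext => x; rewrite subrr.
Qed.

Lemma null_single (X : choiceType) (a : R) (x : X) :
  null_family (fun y => a * (x == y)%:R).
Proof.
move=> I oI; apply: sub_finite_set (finite_set1 x) => y /=.
by case: eqP => // _; rewrite mulr0 => /(_ (ori0 oI)).
Qed.

Lemma family_sum_single (X : choiceType) (a : R) (x : X) (g : X -> R) :
  family_sum (fun y => a * (x == y)%:R * g y) = a * g x.
Proof.
apply: eq_ori => I oI.
have := @family_sum_ori _ _ (fun y => a * (x == y)%:R * g y) [fset x]%fset I.
rewrite big_seq_fset1 eqxx mulr1; apply=> //.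
  by apply: null_mulr; exact: null_single.
by move=> y; rewrite inE eq_sym => /negPf ->; rewrite mulr0 mul0r; exact: ori0.
Qed.

End FamilySums.

(** * The group structure of [R[[X]]] and the monad laws *)

Section Lincomb.
Variable R : completeRightLinearRingType.
Implicit Types X Y Z : choiceType.

Lemma lincomb_ext (X : Type) (r s : lincomb R X) :
  (forall x, r x = s x) -> r = s.
Proof.
case: r s => [r hr] [s hs] /= /funext rs.
by case: _ / rs in hs *; congr LinComb; exact: Prop_irrelevance.
Qed.

Section Zmodule.
Variable X : choiceType.

(** Opposite and sum are derived from the difference, so that [nullB] is the one convergence
    argument behind all three operations. *)
Definition lincomb_sub (r s : lincomb R X) : lincomb R X :=
  LinComb (nullB (coef_null r) (coef_null s)).
Definition lincomb_zero : lincomb R X := LinComb (@null0 R X).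
Definition lincomb_opp (r : lincomb R X) := lincomb_sub lincomb_zero r.
Definition lincomb_add (r s : lincomb R X) := lincomb_sub r (lincomb_opp s).

Fact lincomb_addA : associative lincomb_add.
Proof. by move=> r s t; apply: lincomb_ext => x /=; rewrite !sub0r !opprK addrA. Qed.
Fact lincomb_addC : commutative lincomb_add.
Proof. by move=> r s; apply: lincomb_ext => x /=; rewrite !sub0r !opprK addrC. Qed.
Fact lincomb_add0 : left_id lincomb_zero lincomb_add.
Proof. by move=> r; apply: lincomb_ext => x /=; rewrite !sub0r opprK. Qed.
Fact lincomb_addN : left_inverse lincomb_zero lincomb_opp lincomb_add.
Proof. by move=> r; apply: lincomb_ext => x /=; rewrite !sub0r opprK addNr. Qed.

HB.instance Definition _ := GRing.isZmodule.Build (lincomb R X)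
  lincomb_addA lincomb_addC lincomb_add0 lincomb_addN.

Lemma coefB (r s : lincomb R X) x : (r - s) x = r x - s x.
Proof. by rewrite /= !sub0r opprK. Qed.

End Zmodule.

Lemma lincomb_mapE X Y (f : X -> Y) (r : lincomb R X) y :
  lincomb_map f r y = family_sum (fun x => r x * (f x == y)%:R).
Proof. exact: pushforward_sumE. Qed.

Lemma lincomb_map_comp X Y Z (f : X -> Y) (g : Y -> Z) (r : lincomb R X) :
  lincomb_map g (lincomb_map f r) = lincomb_map (g \o f) r.
Proof.
apply: lincomb_ext => z; rewrite !lincomb_mapE.
exact: (pushforward_sum f (fun y => (g y == z)%:R) (coef_null r)).
Qed.

Lemma lincomb_map_unit X Y (f : X -> Y) x :
  lincomb_map f (lincomb_unit R x) = lincomb_unit R (f x).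
Proof.
apply: lincomb_ext => y; rewrite lincomb_mapE.
exact: (family_sum_delta x (fun z => (f z == y)%:R)).
Qed.

(** The outer sum is reindexed by [X], even when [f] is not injective; the monad identities below
    are checked through this formula. *)
Lemma lincomb_join_map X Y (f : X -> lincomb R Y) (r : lincomb R X) y :
  lincomb_join (lincomb_map f r) y = family_sum (fun x => r x * f x y).
Proof. exact: (pushforward_sum f (fun u => u y) (coef_null r)). Qed.

Lemma lincomb_map_join X Y (f : X -> Y) (c : lincomb R (lincomb R X)) :
  lincomb_map f (lincomb_join c) = lincomb_join (lincomb_map (lincomb_map f) c).
Proof.
apply: lincomb_ext => y; rewrite lincomb_join_map lincomb_mapE.
rewrite (family_sum_exchange (c := @coef R X)) //;
  [|exact: coef_null|exact: coef_null].
by congr family_sum; apply/funext => u; rewrite lincomb_mapE.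
Qed.

(** Associativity of the monad is an exchange of two convergent sums. *)
Lemma lincomb_join_join X (c : lincomb R (lincomb R (lincomb R X))) :
  lincomb_join (lincomb_join c) = lincomb_join (lincomb_map (@lincomb_join R X) c).
Proof.
apply: lincomb_ext => x; rewrite lincomb_join_map /=.
by rewrite (family_sum_exchange (c := @coef R _)) //; exact: coef_null.
Qed.

Lemma lincomb_join_unit X (r : lincomb R X) :
  lincomb_join (lincomb_unit R r) = r.
Proof.
by apply: lincomb_ext => x; exact: (family_sum_delta r (fun u => u x)).
Qed.

Lemma lincomb_map_id X (r : lincomb R X) : lincomb_map id r = r.
Proof.
apply: lincomb_ext => x; rewrite lincomb_mapE -[RHS](family_sum_delta x r).
congr family_sum; apply/funext => y.
by rewrite eq_sym; case: eqP; rewrite ?(mul1r, mulr1, mul0r, mulr0).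
Qed.

Lemma lincomb_join_map_unit X (r : lincomb R X) :
  lincomb_join (lincomb_map (@lincomb_unit R X) r) = r.
Proof.
by rewrite -[RHS]lincomb_map_id; apply: lincomb_ext => x;
  rewrite lincomb_join_map lincomb_mapE.
Qed.

Lemma lincomb_joinB X (c d : lincomb R (lincomb R X)) :
  lincomb_join (c - d) = lincomb_join c - lincomb_join d.
Proof.
apply: lincomb_ext => x; rewrite coefB /=.
rewrite -family_sumB; [|exact/null_mulr/coef_null..].
by congr family_sum; apply/funext => u; rewrite !sub0r opprK mulrBl.
Qed.

Lemma lincomb_mapB X Y (f : X -> Y) (r s : lincomb R X) :
  lincomb_map f (r - s) = lincomb_map f r - lincomb_map f s.
Proof.
apply: lincomb_ext => y; rewrite coefB !lincomb_mapE.
rewrite -family_sumB; [|exact/null_mulr/coef_null..].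
by congr family_sum; apply/funext => u; rewrite coefB mulrBl.
Qed.

Lemma lincomb_map0 X Y (f : X -> Y) : lincomb_map f (0 : lincomb R X) = 0.
Proof. by rewrite -(subrr 0) lincomb_mapB subrr. Qed.

Definition lincomb_single X (a : R) (x : X) : lincomb R X :=
  LinComb (null_single a x).

Lemma lincomb_map_single X Y (f : X -> Y) a x :
  lincomb_map f (lincomb_single a x) = lincomb_single a (f x).
Proof.
apply: lincomb_ext => y; rewrite lincomb_mapE.
exact: (family_sum_single a x (fun z => (f z == y)%:R)).
Qed.

Lemma lincomb_single1 X (x : X) : lincomb_single 1 x = lincomb_unit R x.
Proof. by apply: lincomb_ext => y /=; rewrite mul1r. Qed.

End Lincomb.

(** * Linear structure of contramodules; free contramodules and their morphisms *)

Section Contramodules.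
Variable R : completeRightLinearRingType.
Implicit Types (X : choiceType) (C D : contramodType R).

Fact contrahom_comp_subproof (C D A : contramodType R) (g : contrahom D A)
    (f : contrahom C D) (c : lincomb R C) :
  (g \o f) (contraact c) = contraact (lincomb_map (g \o f) c).
Proof. by rewrite /= !contrahomP lincomb_map_comp. Qed.

Definition contrahom_comp (C D A : contramodType R) (g : contrahom D A)
    (f : contrahom C D) : contrahom C A :=
  ContraHom (contrahom_comp_subproof g f).

Definition contrahom_id D : contrahom D D :=
  @ContraHom R D D id (fun c => esym (congr1 contraact (lincomb_map_id c))).

(** Difference in the abelian group underlying a contramodule; the zero of this group is
    [contraact 0]. *)
Definition contra_sub D (x y : D) : D :=
  contraact (lincomb_unit R x - lincomb_unit R y).

(** Associativity of the contraaction, applied to the formal difference of [r] and [s] in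
    [R[[R[[D]]]]]. *)
Lemma contra_subE D (r s : lincomb R D) :
  contra_sub (contraact r) (contraact s) = contraact (r - s).
Proof.
rewrite /contra_sub -!lincomb_map_unit -lincomb_mapB -contraact_join.
by rewrite lincomb_joinB !lincomb_join_unit.
Qed.

Lemma contra_sub_id D (x : D) : contra_sub x x = contraact 0.
Proof. by rewrite /contra_sub subrr. Qed.

Lemma contrahom0 C D (f : contrahom C D) : f (contraact 0) = contraact 0.
Proof. by rewrite contrahomP lincomb_map0. Qed.

Lemma contrahom_sub C D (f : contrahom C D) x y :
  f (contra_sub x y) = contra_sub (f x) (f y).
Proof. by rewrite contrahomP lincomb_mapB !lincomb_map_unit. Qed.

(** Makes congruence modulo an image compatible with infinite combinations. Associativity reduces it
    to distributivity in [R], coefficient by coefficient. *)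
Lemma contraact_sub X D (u v : X -> D) (r : lincomb R X) :
  contra_sub (contraact (lincomb_map u r)) (contraact (lincomb_map v r)) =
  contraact (lincomb_map (fun x => contra_sub (u x) (v x)) r).
Proof.
rewrite contra_subE.
rewrite -[in RHS](lincomb_map_comp
  (fun x => lincomb_unit R (u x) - lincomb_unit R (v x)) contraact).
rewrite -contraact_join; congr contraact; apply: lincomb_ext => d.
rewrite lincomb_join_map coefB !lincomb_mapE -family_sumB;
  [|exact/null_mulr/coef_null..].
by congr family_sum; apply/funext => x; rewrite coefB mulrBr.
Qed.

Definition contra_scale D (a : R) (x : D) : D := contraact (lincomb_single a x).

Lemma contrahom_scale C D (f : contrahom C D) a x :
  f (contra_scale a x) = contra_scale a (f x).
Proof. by rewrite contrahomP lincomb_map_single. Qed.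

Lemma contra_scale1 D (x : D) : contra_scale 1 x = x.
Proof. by rewrite /contra_scale lincomb_single1 contraact_unit. Qed.

Lemma contra_scale_regular (a : R) (s : regular_contra R) :
  contra_scale a s = a * s :> R.
Proof. exact: (family_sum_single a s id). Qed.

Fact regular_orbit_subproof D (x : D) (c : lincomb R (regular_contra R)) :
  contra_scale (contraact c) x =
  contraact (lincomb_map (fun s : regular_contra R => contra_scale s x) c).
Proof.
rewrite -[in RHS](lincomb_map_comp
  (fun s : regular_contra R => lincomb_single s x) contraact).
rewrite -contraact_join; congr contraact; apply: lincomb_ext => d.
by rewrite lincomb_join_map; exact: family_sum_mulr (coef_null c).
Qed.

(** The morphism from the free contramodule on one generator that sends [1] to [x]; by
    [contrahom_regularE] every morphism from it has this form. *)
Definition regular_orbit D (x : D) : contrahom (regular_contra R) D :=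
  ContraHom (regular_orbit_subproof x).

Lemma contrahom_regularE D (f : contrahom (regular_contra R) D) s :
  f s = contra_scale s (f (1 : R)).
Proof.
by rewrite -contrahom_scale; congr (f _); rewrite contra_scale_regular mulr1.
Qed.

Definition free_contra X : Type := lincomb R X.
HB.instance Definition _ X := Choice.on (free_contra X).
HB.instance Definition _ X := isContramodule.Build R (free_contra X)
  (@lincomb_join_join R X) (@lincomb_join_unit R X).

Lemma coef_free_sub X (v w : free_contra X) x :
  coef (contra_sub v w) x = coef v x - coef w x.
Proof.
rewrite -coefB; congr (coef _ x).
by rewrite [LHS]lincomb_joinB !lincomb_join_unit.
Qed.

Fact free_lift_subproof X D (u : X -> D) (c : lincomb R (free_contra X)) :
  contraact (lincomb_map u (contraact c : free_contra X)) =
  contraact (lincomb_map (fun r : free_contra X => contraact (lincomb_map u r)) c).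
Proof. by rewrite lincomb_map_join contraact_join lincomb_map_comp. Qed.

Definition free_lift X D (u : X -> D) : contrahom (free_contra X) D :=
  ContraHom (free_lift_subproof u).

Definition free_gen X (x : X) : free_contra X := lincomb_unit R x.

Lemma free_lift_gen X D (u : X -> D) x : free_lift u (free_gen x) = u x.
Proof. by rewrite /= lincomb_map_unit contraact_unit. Qed.

(** By a unit law of the monad, every element is the contraaction of a formal combination of
    generators. *)
Lemma free_hom_ext X D (f g : contrahom (free_contra X) D) :
  (forall x, f (free_gen x) = g (free_gen x)) -> f =1 g.
Proof.
move=> fg r; rewrite -[r](lincomb_join_map_unit (r : lincomb R X)).
rewrite [LHS](contrahomP f) [RHS](contrahomP g) !lincomb_map_comp.
by congr (contraact (lincomb_map _ _)); apply/funext => x; exact: fg.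
Qed.

Lemma coef_free_hom X Y (f : contrahom (free_contra X) (free_contra Y)) v y :
  coef (f v) y = family_sum (fun x => coef v x * coef (f (free_gen x)) y).
Proof.
rewrite (free_hom_ext (g := free_lift (fun x => f (free_gen x)))); last first.
  by move=> x; rewrite free_lift_gen.
exact: (lincomb_join_map (fun x => f (free_gen x) : lincomb R Y)).
Qed.

(** The matrix of [f] multiplies the coefficients of [v] from the right, so a right ideal absorbs
    its entries; open right ideals are stable under convergent sums. *)
Lemma free_hom_ori X Y (f : contrahom (free_contra X) (free_contra Y)) v I :
  open_right_ideal I -> (forall x, I (coef v x)) ->
  forall y, I (coef (f v) y).
Proof.
move=> oI vI y; rewrite coef_free_hom; apply: family_sum_in => //.
  exact/null_mulr/coef_null.
by move=> x; exact: oriM.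
Qed.

End Contramodules.

(** * Cokernels of contramodule morphisms *)

Section Cokernel.
Variables (R : completeRightLinearRingType) (C D : contramodType R).
Variable e : contrahom C D.

Definition coker_rel (x y : D) : bool := `[< exists c, contra_sub x y = e c >].

Fact coker_rel_equiv : equiv_class_of coker_rel.
Proof.
(* The image of [e] is closed under differences; symmetry then uses [0 - (x - y)] and transitivity
   [(x - y) - (z - y)]. *)
have subE (r s : lincomb R D) c c' :
    contraact r = e c -> contraact s = e c' -> exists d, contraact (r - s) = e d.
  by move=> rE sE; exists (contra_sub c c'); rewrite -contra_subE rE sE contrahom_sub.
have zE : contraact 0 = e (contraact 0) by rewrite contrahom0.
have sym x y : coker_rel x y -> coker_rel y x.
  move=> /asboolP[c xy]; apply/asboolP.
  by have := subE _ _ _ _ zE xy; rewrite sub0r opprB.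
split.
- by move=> x; apply/asboolP; exists (contraact 0); rewrite contra_sub_id.
- by move=> x y; apply/idP/idP; exact: sym.
move=> y x z xy /sym /asboolP[c' zy]; apply/asboolP; move: xy => /asboolP[c xy].
by have := subE _ _ _ _ xy zy; rewrite opprB addrA subrK.
Qed.

Canonical coker_equiv := EquivRelPack coker_rel_equiv.

Definition coker : Type := {eq_quot coker_equiv}.
HB.instance Definition _ := Choice.on coker.

Definition coker_pi (x : D) : coker := \pi_{eq_quot coker_equiv} x.
Definition coker_repr (x : coker) : D := repr (x : {eq_quot coker_equiv}).

Lemma coker_reprK x : coker_pi (coker_repr x) = x.
Proof. exact: reprK. Qed.

Lemma coker_piP x y :
  coker_pi x = coker_pi y <-> exists c, contra_sub x y = e c.
Proof.
split=> [/eqP|h]; first by rewrite eqmodE => /asboolP.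
by apply/eqP; rewrite eqmodE; apply/asboolP.
Qed.

(** Choose a preimage under [e] of each difference; the same combination of these preimages maps to
    the difference of the two values. Hence [coker_act] does not depend on the chosen
    representatives. *)
Lemma coker_pi_contraact (X : choiceType) (u v : X -> D) (r : lincomb R X) :
  (forall x, coker_pi (u x) = coker_pi (v x)) ->
  coker_pi (contraact (lincomb_map u r)) = coker_pi (contraact (lincomb_map v r)).
Proof.
move=> uv.
have /choice[w wE] x : exists c, contra_sub (u x) (v x) = e c by exact/coker_piP.
apply/coker_piP; exists (contraact (lincomb_map w r)).
rewrite contraact_sub contrahomP lincomb_map_comp.
by congr (contraact (lincomb_map _ _)); apply/funext.
Qed.

Definition coker_act (r : lincomb R coker) : coker :=
  coker_pi (contraact (lincomb_map coker_repr r)).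

Fact coker_act_join (c : lincomb R (lincomb R coker)) :
  coker_act (lincomb_join c) = coker_act (lincomb_map coker_act c).
Proof.
rewrite /coker_act lincomb_map_join contraact_join !lincomb_map_comp.
by apply: coker_pi_contraact => r /=; rewrite coker_reprK.
Qed.

Fact coker_act_unit x : coker_act (lincomb_unit R x) = x.
Proof. by rewrite /coker_act lincomb_map_unit contraact_unit coker_reprK. Qed.

HB.instance Definition _ :=
  isContramodule.Build R coker coker_act_join coker_act_unit.

Fact coker_proj_subproof (r : lincomb R D) :
  coker_pi (contraact r) = contraact (lincomb_map coker_pi r).
Proof.
rewrite -[RHS]/(coker_act _) /coker_act lincomb_map_comp.
rewrite -[r in LHS]lincomb_join_map_unit.
rewrite contraact_join lincomb_map_comp; apply: coker_pi_contraact => x /=.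
by rewrite contraact_unit coker_reprK.
Qed.

Definition coker_proj : contrahom D coker := ContraHom coker_proj_subproof.

Lemma coker_projP x y :
  coker_proj x = coker_proj y <-> exists c, contra_sub x y = e c.
Proof. exact: coker_piP. Qed.

End Cokernel.

(** * Epimorphisms, projectives, and generators of Bass flat contramodules *)

Section Category.
Variable R : completeRightLinearRingType.
Implicit Types (X : choiceType) (C D P B : contramodType R).

(** The projection to the cokernel and the zero morphism agree after [e], hence coincide, so every
    [d] is zero modulo the image. *)
Lemma contra_epi_surj C D (e : contrahom C D) :
  contra_epi e -> forall d, exists c, e c = d.
Proof.
move=> epi_e d.
pose z := coker_proj e (contraact 0).
(* [z] is the zero of the cokernel, so the constant map with value [z] is a morphism. *)
have zP (r : lincomb R D) : z = contraact (lincomb_map (fun=> z) r).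
  rewrite /z contrahom0.
  rewrite -[in RHS](lincomb_map_comp (fun=> 0) contraact) -contraact_join.
  congr contraact; apply: lincomb_ext => x; rewrite lincomb_join_map.
  under eq_fun do rewrite mulr0.
  by rewrite family_sum0.
have /epi_e/(_ d)/coker_projP[c dc] :
    coker_proj e \o e =1 ContraHom zP \o e.
  move=> c; apply/coker_projP; exists c.
  rewrite -(contrahom0 e) -contrahom_sub; congr (e _).
  by rewrite -[X in contra_sub X _]contraact_unit contra_subE subr0 contraact_unit.
exists c; rewrite -dc.
by rewrite -[X in contra_sub X _]contraact_unit contra_subE subr0 contraact_unit.
Qed.

Lemma free_projective X : contra_projective (free_contra R X).
Proof.
move=> C D e /contra_epi_surj e_surj f.
have /choice[u uE] x : exists c, e c = f (free_gen R x) by exact: e_surj.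
exists (free_lift u).
apply: (free_hom_ext (f := contrahom_comp e (free_lift u))) => x.
by rewrite /contrahom_comp [LHS]/comp free_lift_gen.
Qed.

Lemma retract_projective P B (u : contrahom B P) (l : contrahom P B) :
  l \o u =1 id -> contra_projective P -> contra_projective B.
Proof.
move=> lu projP C D e epi_e f.
have [g gE] := projP _ _ e epi_e (contrahom_comp f l).
by exists (contrahom_comp g u) => x; rewrite -[x in RHS]lu; exact: gE.
Qed.

(** A morphism from [R] amounts to the image of [1], and precomposing it with right multiplication
    by [a n] scales that image by [a n]. Cocones thus become sequences of elements. *)
Lemma bass_flat_gens B : bass_flat B -> exists (a : nat -> R) (b : nat -> B),
  (forall n, b n = contra_scale (a n) (b n.+1)) /\
  forall D (x : nat -> D), (forall n, x n = contra_scale (a n) (x n.+1)) ->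
  exists u : contrahom B D, (forall n, u (b n) = x n) /\
    forall v : contrahom B D, (forall n, v (b n) = x n) -> v =1 u.
Proof.
move=> [a [i [coc lim]]]; exists a, (fun n => i n (1 : R)); split=> [n|D x xE].
  by rewrite -coc -contrahom_regularE /= mul1r.
have [n s|u [uE u_uniq]] := lim D (fun n => regular_orbit (x n)).
  rewrite /= (xE n).
  rewrite -[LHS]/(regular_orbit (x n.+1) ((s : R) * a n : R)).
  by rewrite -(contra_scale_regular s (a n)) contrahom_scale.
exists u; split=> [n|v vE].
  by rewrite -[LHS]/((u \o i n) _) uE /= contra_scale1.
apply: u_uniq => n s.
by rewrite [LHS](contrahom_regularE (contrahom_comp v (i n))) /= vE.
Qed.

End Category.

(** * The telescope map and the endomorphisms collapsing it *)

Section Telescope.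
Variables (R : completeRightLinearRingType) (a : nat -> R).

Definition telescope : contrahom (free_contra R nat) (free_contra R nat) :=
  free_lift (fun n =>
    contra_sub (free_gen R n) (contra_scale (a n) (free_gen R n.+1))).

(* [push d n] is a_n ... a_{n+d-1} e_{n+d}. *)
Fixpoint push (d n : nat) : free_contra R nat :=
  if d is d'.+1 then contra_scale (a n) (push d' n.+1) else free_gen R n.

(** Since [m - n] is truncated, generators of index at least [m] are fixed. *)
Definition collapse (m : nat)
    : contrahom (free_contra R nat) (free_contra R nat) :=
  free_lift (fun n => push (m - n) n).

(** The composite kills the generators below [m], so only coefficients of [y] that lie in [I]
    contribute. *)
Lemma collapse_telescope m y I : open_right_ideal I ->
  (forall n, (m <= n)%N -> I (coef y n)) ->
  forall n, I (coef (collapse m (telescope y)) n).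
Proof.
move=> oI yI n.
rewrite -[collapse m _]/(contrahom_comp (collapse m) telescope y) coef_free_hom.
apply: family_sum_in => // [|j]; first exact/null_mulr/coef_null.
have [mj|jm] := leqP m j; first by apply: oriM => //; exact: yI.
rewrite -[contrahom_comp _ _ _]/(collapse m (telescope _)) free_lift_gen.
rewrite contrahom_sub contrahom_scale !free_lift_gen.
(* As [j < m], unfolding one step of [push] shows that [e_j] and [a_j e_{j+1}] have the same image,
   so the two terms cancel. *)
rewrite -[(m - j)%N]prednK ?subn_gt0 // -subnS [push _.+1 j]/=.
rewrite coef_free_sub subrr mulr0.
exact: ori0.
Qed.

Section Cocone.
Variables (D : contramodType R) (b : nat -> D).
Hypothesis bE : forall n, b n = contra_scale (a n) (b n.+1).

Lemma free_lift_push d n : free_lift b (push d n) = b n.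
Proof.
elim: d n => [|d IHd] n; first exact: free_lift_gen.
by rewrite [push _ _]/= contrahom_scale IHd -bE.
Qed.

Lemma free_lift_collapse m : free_lift b \o collapse m =1 free_lift b.
Proof.
apply: (free_hom_ext (f := contrahom_comp (free_lift b) (collapse m))) => n.
by rewrite -[LHS]/(free_lift b (collapse m _)) !free_lift_gen free_lift_push.
Qed.

End Cocone.
End Telescope.

(** * From a projective cover to projectivity *)

Theorem corollary3p10 (R : completeRightLinearRingType) (B : contramodType R)
  (hB : bass_flat B) (hcov : has_projective_cover B) : contra_projective B.
Proof.
have [a [b [bE b_univ]]] := bass_flat_gens hB.
have [P [l [[projP l_pre] l_cov]]] := hcov.
pose q := free_lift b.
(* Morphisms from [B] are determined by their values on the [b n], which lie in the image of [q]. *)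
have q_epi : contra_epi q.
  move=> A g h gh.
  have ghb n : g (b n) = h (b n).
    by have := gh (free_gen R n); rewrite [LHS]/comp [RHS]/comp free_lift_gen.
  have [|u [_ u_uniq]] := b_univ A (fun n => g (b n)).
    by move=> n; rewrite -contrahom_scale -bE.
  by move=> x; rewrite (u_uniq g) // (u_uniq h).
have q_ker v w : q v = q w -> exists y, contra_sub v w = telescope a y.
  move=> qvw; apply/coker_projP.
  (* Let [u] send [b n] to the class of [e_n] modulo the image of the telescope. Then [u] after [q]
     is the projection, so [q v = q w] makes the classes of [v] and [w] equal. *)
  have [n|u [uE _]] :=
      b_univ _ (fun n => coker_proj (telescope a) (free_gen R n)).
    rewrite -contrahom_scale; apply/coker_projP; exists (free_gen R n).
    by rewrite free_lift_gen.
  have uq : contrahom_comp u q =1 coker_proj (telescope a).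
    by apply: free_hom_ext => n; rewrite -[LHS]/(u (q _)) free_lift_gen uE.
  by rewrite -!uq; congr (u _).
have [g gE] := projP _ _ q q_epi l.
have [h hE] := l_pre _ (@free_projective R nat) q.
have hg_auto : contra_automorphism (contrahom_comp h g).
  by apply: l_cov => x; rewrite -[LHS]/((l \o h) (g x)) hE; exact: gE.
have l_inj x x' : l x = l x' -> x = x'.
  move=> lxx'; have [hg' [hgK _]] := hg_auto; apply: (can_inj hgK).
  (* As [h g] is injective, it suffices to compare [g x] and [g x'], coefficientwise and modulo each
     [I]. *)
  congr (h _); apply: lincomb_ext => n; apply: eq_ori => I oI.
  have [y yE] := q_ker (g x) (g x') (etrans (gE x) (etrans lxx' (esym (gE x')))).
  have [A hA] := null_fset (coef_null y) oI.
  (* Every index from [m] on lies outside [A], so its coefficient in [y] is in [I]. *)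
  pose m := (\max_(j <- A) j).+1.
  have [|f [fK _]] :=
      l_cov (contrahom_comp h (contrahom_comp (collapse a m) g)).
    move=> p; rewrite -[LHS]/((l \o h) (collapse a m (g p))) hE.
    by rewrite -[LHS]/((q \o collapse a m) (g p)) free_lift_collapse //; exact: gE.
  (* Here [f] inverts [h c_m g], so [g f h] sends [c_m (g x)] back to [g x], and likewise for [x'].
     Being an endomorphism of the free contramodule, [g f h] preserves coefficients in [I]. *)
  have -> : coef (g x) n - coef (g x') n =
      coef (contrahom_comp g (contrahom_comp f h) (collapse a m (telescope a y))) n.
    rewrite -yE !contrahom_sub coef_free_sub.
    by congr (coef (g _) n - coef (g _) n); rewrite -[RHS]/(f _); exact/esym/fK.
  apply: free_hom_ori => //; apply: collapse_telescope => // j mj; apply: hA.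
  apply: contraL mj => jA; rewrite -ltnNge ltnS.
  by rewrite (big_rem j jA) leq_maxl.
(* The relations among the [h e_n] hold after applying [l], hence in [P] by injectivity. *)
have [n|u [uE _]] := b_univ P (fun n => h (free_gen R n)).
  apply: l_inj; rewrite contrahom_scale -![l (h _)]/((l \o h) _) !hE.
  by rewrite !free_lift_gen -bE.
(* By uniqueness, an endomorphism of [B] fixing every [b n] is the identity; [l u] is one. *)
have [//|w [_ w_uniq]] := b_univ B b.
apply: (retract_projective (u := u) (l := l)) projP => x.
rewrite -[RHS]/(contrahom_id B x) (w_uniq (contrahom_id B)) //.
rewrite -[LHS]/(contrahom_comp l u x) (w_uniq (contrahom_comp l u)) // => n.
by rewrite -[LHS]/(l (u _)) uE -[LHS]/((l \o h) _) hE free_lift_gen.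
Qed.
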